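(* Let $S$ be a ring and $R$ a subring of $S$ which is an integral domain contained in the center of $S$; assume that $S$ is a free $R$-module of finite rank $n$. Let $\widetilde G$ be a closed subgroup of $\operatorname{GL}(n,\overline{k})$, $G'=\widetilde G(R)=\widetilde G\cap \operatorname{GL}(n,R)$, and $T'=T\cap G'$. Suppose that (i) $\widetilde G$ is a connected reductive group; (ii) $\widetilde T\cap\widetilde G$ is a maximal torus in $\widetilde G$; (iii) the group $T'$ is Zariski dense in $\widetilde T\cap\widetilde G$. Then the lower garland of the lattice $\mathrm{Lat}(T',G')$ coincides with the interval $\mathrm{Lat}(T',N_{G'}(T'))$.
   Context: Rings are associative with unit, subrings are unitary. Fix an $R$-basis $\omega_1,\dots,\omega_n$ of $S$. For $\alpha\in S$ let $t(\alpha)=(t_{ij}(\alpha))\in M(n,R)$ be given by $\omega_i\alpha=\sum_{j=1}^n t_{ji}(\alpha)\omega_j$. Put $T=t(S^* )\leqslant\operatorname{GL}(n,R)$. Let $k$ be the quotient field of $R$ and $\overline{k}$ its algebraic closure. Extend $t$ by the same formula (with basis $1\otimes\omega_i$) to $\overline{k}\otimes_RS$ and put $\widetilde T=t((\overline{k}\otimes_RS)^* )\leqslant\operatorname{GL}(n,\overline{k})$. For groups $A\leqslant B$, $\mathrm{Lat}(A,B)=\{H: A\leqslant H\leqslant B\}$ is the lattice of intermediate subgroups. Its normality graph has the intermediate subgroups as vertices, two of them being joined by an edge iff one of them is normal in the other. A garland is a connected component of the normality graph; the lower garland is the one containing $A$. $N_{G'}(\cdot)$ is the normalizer in $G'$.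 *)

(* Defs.v *)
From HB Require Import structures.
From mathcomp Require Import all_boot all_order all_algebra.
From mathcomp Require Import boolp classical_sets topology.
(* Its notations clash with those of the analysis library. *)
From mathcomp Require Import -(notations) mpoly.
From Stdlib Require Import Relation_Operators.

Set Implicit Arguments.
Unset Strict Implicit.
Unset Printing Implicit Defensive.

Import GRing.Theory.
Local Open Scope classical_set_scope.
Local Open Scope ring_scope.

Section MatrixGroups.
Variables (F : comUnitRingType) (n : nat).
Implicit Types A B H N : set 'M[F]_n.

Definition GL : set 'M[F]_n := [set g | g \in unitmx].

Definition subgroup H : Prop :=
  [/\ H `<=` GL, H 1%:M,
      forall g h, H g -> H h -> H (g *m h) &
      forall g, H g -> H (invmx g)].

Definition conjg_set H (g : 'M[F]_n) : set 'M[F]_n :=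
  [set g *m h *m invmx g | h in H].

Definition normal_in N H : Prop :=
  N `<=` H /\ forall g, H g -> conjg_set N g `<=` N.

Definition normalizer H A : set 'M[F]_n :=
  [set g | H g /\ conjg_set A g = A].

Definition Lat A B : set (set 'M[F]_n) :=
  [set H | [/\ subgroup H, A `<=` H & H `<=` B]].

Definition normality_edge A B H1 H2 : Prop :=
  [/\ Lat A B H1, Lat A B H2 & normal_in H1 H2 \/ normal_in H2 H1].

(* The connected component of H in the normality graph; the edge relation is
   symmetric, so its reflexive transitive closure is an equivalence. *)
Definition garland A B H : set (set 'M[F]_n) :=
  [set H' | Lat A B H' /\ clos_refl_trans _ (normality_edge A B) H H'].

Definition lower_garland A B : set (set 'M[F]_n) := garland A B A.

End MatrixGroups.

Definition zariski (K : fieldType) (n : nat) : Type := 'M[K]_n.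

Section Zariski.
Variables (K : fieldType) (n : nat).

HB.instance Definition _ := Choice.on (zariski K n).

(* Value at g of a polynomial in the n ^ 2 matrix entries. *)
Definition mx_eval (p : mpoly (n * n) K) (g : 'M[K]_n) : K :=
  meval (mxvec g 0) p.

Definition zeros (P : set (mpoly (n * n) K)) : set 'M[K]_n :=
  [set g | forall p, P p -> mx_eval p g = 0].

Definition zariski_open (U : set (zariski K n)) : Prop :=
  exists P, U = ~` zeros P.

Fact zariski_openT : zariski_open setT.
Proof.
exists [set (1 : mpoly (n * n) K)]; rewrite -setC0; congr (~` _); apply/esym/seteqP; split => // g.
by move/(_ 1 erefl)/eqP; rewrite /mx_eval meval1 oner_eq0.
Qed.

Fact zariski_openI : setI_closed zariski_open.
Proof.
move=> _ _ [P ->] [Q ->].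
exists [set r | exists p q, [/\ P p, Q q & r = p * q]].
rewrite -setCU; congr (~` _); apply/seteqP; split => g.
  move=> ZPQ _ [p [q [Pp Qq ->]]]; apply/eqP; rewrite /mx_eval mevalM mulf_eq0.
  by case: ZPQ => Zg; apply/orP; [left | right]; apply/eqP/Zg.
move=> Zg; case: (EM (zeros P g)) => [|nPg]; [by left | right => q Qq].
have /existsNP [p /not_implyP [Pp pg]] := nPg.
have /eqP : mx_eval (p * q) g = 0 by apply: Zg; exists p, q.
by rewrite /mx_eval mevalM mulf_eq0 => /orP [/eqP|/eqP].
Qed.

Fact zariski_open_bigU (I : Type) (f : I -> set (zariski K n)) :
  (forall i, zariski_open (f i)) -> zariski_open (\bigcup_i f i).
Proof.
move=> /choice [P fE]; exists (\bigcup_i P i).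
rewrite (eq_bigcupr (fun i _ => fE i)) -setC_bigcap; congr (~` _).
apply/seteqP; split => g Zg; first by move=> p [i _ Pp]; exact: (Zg i _ p Pp).
by move=> i _ p Pp; apply: Zg; exists i.
Qed.

HB.instance Definition _ := isOpenTopological.Build (zariski K n)
  zariski_openT zariski_openI zariski_open_bigU.

Definition zclosed_subgroup (H : set 'M[K]_n) : Prop :=
  subgroup H /\
  exists2 C : set (zariski K n), closed C & H = (@GL K n) `&` C.

Definition zconnected (H : set 'M[K]_n) : Prop :=
  connected (H : set (zariski K n)).

Definition zdense_in (X Y : set 'M[K]_n) : Prop :=
  X `<=` Y /\ Y `<=` closure (X : set (zariski K n)).

End Zariski.

(* Sets of K-points stand for algebraic groups, so the definitions below have
   their usual meaning for K algebraically closed. *)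

Section AlgebraicGroups.
Variable K : fieldType.

(* K[GL_n] is generated by the matrix entries and the inverse of the
   determinant, and a regular map on a closed subset of GL_n is the restriction
   of one on GL_n. *)
Definition regular_map (n m : nat) (H : set 'M[K]_n) (f : 'M[K]_n -> 'M[K]_m) :=
  exists (P : 'I_m -> 'I_m -> mpoly (n * n) K) (e : nat),
    forall g, H g -> forall i j, f g i j = mx_eval (P i j) g / \det g ^+ e.

Definition alg_group_morphism (n m : nat)
    (H : set 'M[K]_n) (H' : set 'M[K]_m) (f : 'M[K]_n -> 'M[K]_m) : Prop :=
  [/\ regular_map H f, forall g, H g -> H' (f g) &
      forall g h, H g -> H h -> f (g *m h) = f g *m f h].

Definition alg_group_isomorphic (n m : nat)
    (H : set 'M[K]_n) (H' : set 'M[K]_m) : Prop :=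
  exists (f : 'M[K]_n -> 'M[K]_m) (f' : 'M[K]_m -> 'M[K]_n),
    [/\ alg_group_morphism H H' f, alg_group_morphism H' H f',
        forall g, H g -> f' (f g) = g & forall g, H' g -> f (f' g) = g].

(* The torus GL_1 ^ d. *)
Definition diag_group (d : nat) : set 'M[K]_d :=
  [set g | g \in unitmx /\ is_diag_mx g].

Variable n : nat.
Implicit Types G H U : set 'M[K]_n.

Definition torus H : Prop :=
  zclosed_subgroup H /\ exists d, alg_group_isomorphic H (@diag_group d).

Definition maximal_torus G H : Prop :=
  [/\ torus H, H `<=` G &
      forall H', torus H' -> H' `<=` G -> H `<=` H' -> H' = H].

Definition unipotent U : Prop :=
  forall g, U g -> exists m, (g - 1%:M) ^+ m = 0.

(* The largest closed connected normal unipotent subgroup of G is the union of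
   all such subgroups. *)
Definition unipotent_radical G : set 'M[K]_n :=
  \bigcup_(U in [set U | [/\ zclosed_subgroup U, zconnected U,
                            normal_in U G & unipotent U]]) U.

Definition reductive G : Prop := unipotent_radical G = [set 1%:M].

End AlgebraicGroups.

Section RegularRepresentation.
Variables (F : comNzRingType) (A : algType F) (n : nat).
Implicit Types (omega : 'I_n -> A) (a : A).

Definition is_basis omega : Prop :=
  forall a, exists! c : 'rV[F]_n, a = \sum_(j < n) c 0 j *: omega j.

Definition is_unit a : Prop := exists b, a * b = 1 /\ b * a = 1.

(* M = t(a); the coordinates of omega i * a are in the i-th column of M. *)
Definition regular_matrix omega a (M : 'M[F]_n) : Prop :=
  forall i, omega i * a = \sum_(j < n) M j i *: omega j.

Definition unit_matrices omega : set 'M[F]_n :=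
  [set M | exists2 a, is_unit a & regular_matrix omega a M].

End RegularRepresentation.

Section ScalarExtension.
Variables (R K : comNzRingType) (phi : {rmorphism R -> K}) (S : algType R).

Definition balanced (V : zmodType) (f : K -> S -> V) : Prop :=
  [/\ forall a b s, f (a + b) s = f a s + f b s,
      forall a s u, f a (s + u) = f a s + f a u &
      forall a r s, f (a * phi r) s = f a (r *: s)].

(* The K-algebra A, with tau a s in the role of the pure tensor of a and s, is
   the tensor product of K and S over R. *)
Record scalar_extension (A : algType K) (tau : K -> S -> A) : Prop := {
  tensor_balanced : balanced tau;
  tensor_universal : forall (V : zmodType) (f : K -> S -> V), balanced f ->
    exists g : {additive A -> V}, (forall a s, g (tau a s) = f a s) /\
      forall g' : {additive A -> V},
        (forall a s, g' (tau a s) = f a s) -> g' =1 g;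
  tensor_scale : forall a b s, a *: tau b s = tau (a * b) s;
  tensor_mul : forall a b s u, tau a s * tau b u = tau (a * b) (s * u)
}.

End ScalarExtension.

Definition algebraic_closure (k : fieldType) (K : closedFieldType)
    (iota : {rmorphism k -> K}) : Prop :=
  forall x : K, algebraicOver iota x.

Definition via_frac (R : idomainType) (K : nzRingType)
    (iota : {rmorphism {fraction R} -> K}) : {rmorphism R -> K} :=
  iota \o @FracField.tofrac R.

(* Main.v *)
Require Import Defs.
From HB Require Import structures.
From mathcomp Require Import all_boot all_order all_algebra.
From mathcomp Require Import boolp classical_sets topology.
From mathcomp Require Import -(notations) mpoly.
From mathcomp Require Import zify.
From Stdlib Require Import Relation_Operators.
Import GRing.Theory.
Local Open Scope classical_set_scope.
Local Open Scope ring_scope.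

(** Let D be the maximal torus of Gt formed by the elements of Gt that lie in
    Tt.  The group T' is exactly the group of integral points of D: if the
    matrix of a unit a of the extended algebra is invertible over R, then
    expanding 1 in the basis shows that a itself comes from a unit of S
    ([unit_matrices_descent]).

    Every H between T' and its normalizer N has T' as a normal subgroup, so it
    is a neighbour of T'.  For the converse, being contained in N has to
    survive each edge of the normality graph, and the only edges in question
    lead from some H contained in N up to an F in which H is normal.  Take g
    in F.  The conjugate of T' by g lies in H, hence normalizes T'; since T'
    is dense in D and these conditions are closed, the conjugate torus D^g
    normalizes D ([conj_normalizes_closure]).

    Tori are rigid: D^g then centralizes D ([toral_set_centralizes]).  Indeed
    D has an element x whose centralizer is that of D; x has only finitely many
    conjugates in D, because a conjugate has the same eigenvalues; and D^g is a
    divisible group, so it acts trivially on this finite set.  Two commuting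
    tori generate a torus ([toral_set_product], [toral_set_torus]), here a
    torus of Gt that contains D, and so equal to D by maximality.  Hence D^g is
    contained in D ([maximal_torus_absorbs]), and conjugation by g preserves
    the set T' of integral points of D.

    All this is made explicit by a description of tori: the tori of GL_n are
    the sets of matrices [\sum_j u ^ M_j *: B_j], where the B_j are nonzero
    orthogonal idempotents with sum 1, the u ^ M_j are Laurent monomials and u
    runs over the vectors with nonzero entries.  That tori have this form is
    the linear independence of characters ([torus_toral]); that these sets are
    tori rests on the Smith normal form of the exponent matrix
    ([toral_set_torus]). *)

Set Implicit Arguments.
Unset Strict Implicit.
Unset Printing Implicit Defensive.

(** * Laurent monomials *)

Section Monomials.
Variable K : fieldType.

Definition nonzero_row d (u : 'rV[K]_d) : Prop := forall i, u 0 i != 0.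

Definition row_mul d (u v : 'rV[K]_d) : 'rV[K]_d := \row_i (u 0 i * v 0 i).

Definition monomials d N (u : 'rV[K]_d) (M : 'M[int]_(d, N)) : 'rV[K]_N :=
  \row_j \prod_i u 0 i ^ M i j.

Lemma prod_expz (I : Type) (r : seq I) (F : I -> K) (z : int) :
  (\prod_(i <- r) F i) ^ z = \prod_(i <- r) F i ^ z.
Proof.
elim: r => [|a r IH]; first by rewrite !big_nil exp1rz.
by rewrite !big_cons expfzMl IH.
Qed.

Lemma expz_sum (I : Type) (r : seq I) (x : K) (F : I -> int) :
  x != 0 -> x ^ (\sum_(i <- r) F i) = \prod_(i <- r) x ^ F i.
Proof.
move=> x0; elim: r => [|a r IH]; first by rewrite !big_nil expr0z.
by rewrite !big_cons expfzDr // IH.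
Qed.

Lemma monomials_neq0 d N (u : 'rV[K]_d) (M : 'M[int]_(d, N)) :
  nonzero_row u -> nonzero_row (monomials u M).
Proof.
by move=> u0 j; rewrite mxE; apply/prodf_neq0 => i _; apply: expfz_neq0.
Qed.

Lemma row_mul_neq0 d (u v : 'rV[K]_d) :
  nonzero_row u -> nonzero_row v -> nonzero_row (row_mul u v).
Proof. by move=> u0 v0 i; rewrite mxE mulf_neq0. Qed.

Lemma monomials_comp d N p (u : 'rV[K]_d) (A : 'M[int]_(d, N))
    (B : 'M[int]_(N, p)) : nonzero_row u ->
  monomials (monomials u A) B = monomials u (A *m B).
Proof.
move=> u0; apply/rowP => j; rewrite !mxE.
under eq_bigr do rewrite mxE prod_expz.
rewrite exchange_big /=; apply: eq_bigr => i _; rewrite mxE expz_sum //.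
by apply: eq_bigr => k _; rewrite exprz_exp.
Qed.

Lemma monomials_scalar d (u : 'rV[K]_d) (c : int) :
  monomials u c%:M = \row_i (u 0 i ^ c).
Proof.
apply/rowP => j; rewrite !mxE (bigD1 j) //= mxE eqxx mulr1n.
rewrite big1 ?mulr1 // => i ij.
by rewrite mxE (negPf ij) mulr0n expr0z.
Qed.

Lemma monomials_id d (u : 'rV[K]_d) : monomials u 1%:M = u.
Proof. by rewrite monomials_scalar; apply/rowP => i; rewrite mxE expr1z. Qed.

Lemma monomials_mul d N (u v : 'rV[K]_d) (M : 'M[int]_(d, N)) :
  monomials (row_mul u v) M = row_mul (monomials u M) (monomials v M).
Proof.
apply/rowP => j; rewrite !mxE -big_split /=.
by apply: eq_bigr => i _; rewrite mxE expfzMl.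
Qed.

Lemma monomials_pow d N (u : 'rV[K]_d) (M : 'M[int]_(d, N)) (c : int) :
  monomials (\row_i (u 0 i ^ c)) M = \row_j (monomials u M 0 j ^ c).
Proof.
apply/rowP => j; rewrite !mxE prod_expz.
by apply: eq_bigr => i _; rewrite mxE exprzAC.
Qed.

Lemma monomials_const1 d N (M : 'M[int]_(d, N)) :
  monomials (const_mx 1) M = const_mx 1.
Proof. by apply/rowP => j; rewrite !mxE big1 // => i _; rewrite mxE exp1rz. Qed.

End Monomials.

(** From the Smith normal form L * diag(d) * R of M, keep the indices k with
    d_k nonzero: Q consists of the columns of L scaled by the d_k, and V of
    the corresponding rows of R.  Read multiplicatively, it writes the monomial
    map M between tori as a surjective monomial map (Q, because Q' inverts it
    up to c-th powers) followed by a closed embedding (V, because V' is a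
    retraction). *)
Lemma int_rank_factorization m n (M : 'M[int]_(m, n)) :
  exists r (Q : 'M[int]_(m, r)) (Q' : 'M[int]_(r, m)) (V : 'M[int]_(r, n))
    (V' : 'M[int]_(n, r)) (c : nat),
    [/\ M = Q *m V, V *m V' = 1%:M, Q' *m Q = (c%:Z)%:M & (0 < c)%N].
Proof.
have [L uL [R uR [d _ ->]]] := int_Smith_normal_form M.
(* f and g turn an index of a nonzero elementary divisor into a row index and
   a column index; c is a common multiple of these divisors. *)
set A := [set k : 'I_(minn m n) | d`_k != 0]%SET.
pose f (k : 'I_#|A|) : 'I_m := widen_ord (geq_minl m n) (enum_val k).
pose g (k : 'I_#|A|) : 'I_n := widen_ord (geq_minr m n) (enum_val k).
pose D k := d`_(enum_val (A := A) k).
have D0 k : D k != 0 by have := enum_valP k; rewrite inE.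
have finj : injective f by move=> i j /(congr1 val) /= /val_inj /enum_val_inj.
have ginj : injective g by move=> i j /(congr1 val) /= /val_inj /enum_val_inj.
pose c := (\prod_k `|D k|)%N.
exists #|A|, (\matrix_(i, k) (L i (f k) * D k)),
  (\matrix_(k, i) ((c%:Z %/ D k)%Z * invmx L (f k) i)),
  (\matrix_(k, j) R (g k) j), (\matrix_(j, k) invmx R j (g k)), c; split.
- apply/matrixP => i j; rewrite !mxE.
  under eq_bigr => k _ do rewrite !mxE.
  under [RHS]eq_bigr => k _ do rewrite !mxE.
  transitivity (\sum_(k : 'I_n) \sum_(l : 'I_m) L i l * (d`_l *+ (l == k :> nat)) * R k j).
    by apply: eq_bigr => k _; rewrite mulr_suml; apply: eq_bigr => l _; rewrite mxE.
  rewrite (bigID (fun k => k \in codom g)) /= [X in _ + X]big1 ?addr0; last first.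
    move=> k kg; rewrite big1 // => l _.
    case: eqP => [lk|_]; last by rewrite mulr0n mulr0 mul0r.
    rewrite mulr1n; suff -> : d`_l = 0 by rewrite mulr0 mul0r.
    apply/eqP; apply: contraR kg => dl.
    have lt : (k < minn m n)%N by rewrite leq_min ltn_ord -lk ltn_ord.
    have kA : Ordinal lt \in A by rewrite inE /= -lk.
    apply/codomP; exists (enum_rank_in kA (Ordinal lt)).
    by apply: val_inj; rewrite /= enum_rankK_in.
  rewrite -big_uniq /=; last by rewrite map_inj_uniq ?enum_uniq.
  rewrite big_map big_enum /=; apply: eq_bigr => k _.
  rewrite (bigD1 (f k)) //= eqxx mulr1n big1 ?addr0 // => l lf.
  rewrite (_ : (l == enum_val k :> nat) = false) ?mulr0n ?mulr0 ?mul0r //.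
  by apply: contraNF lf => /eqP lf; apply/eqP/val_inj.
- apply/matrixP => i j; rewrite !mxE.
  under eq_bigr => k _ do rewrite !mxE.
  have := congr1 (fun X : 'M_n => X (g i) (g j)) (mulmxV uR).
  by rewrite !mxE (inj_eq ginj).
- apply/matrixP => i j; rewrite !mxE.
  under eq_bigr => k _ do rewrite !mxE mulrA -[X in X * D j]mulrA.
  rewrite -mulr_suml -mulr_sumr.
  have := congr1 (fun X : 'M_m => X (f i) (f j)) (mulVmx uL).
  rewrite !mxE (inj_eq finj) => ->; case: eqP => [<-|_]; last by rewrite mulr0 mul0r.
  rewrite mulr1 divzK // /c (bigD1 i) //= PoszM; apply: dvdz_mulr.
  by rewrite dvdzE.
- by rewrite prodn_gt0 // => k; rewrite absz_gt0.
Qed.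

(** * Generic points and independence of characters *)

Lemma int_poly_nonroot (p : {poly int}) : p != 0 -> exists z, p.[z] != 0.
Proof.
move=> p0; set s := [seq i%:Z | i <- iota 0 (size p)].
have us : uniq s by rewrite map_inj_uniq ?iota_uniq // => i j [].
have [/(max_poly_roots p0)/(_ us)|] := boolP (all (root p) s).
  by rewrite size_map size_iota ltnn.
by case/allPn => z _ nz; exists z.
Qed.

(** A one-parameter subgroup of the torus on which distinct characters stay
    distinct: its exponents are the powers of an integer that avoids the roots
    of finitely many nonzero polynomials. *)
Lemma separating_coweight d N (M : 'M[int]_(d, N)) :
  injective (fun j => col j M) ->
  exists b : 'rV[int]_d, injective (fun j => (b *m M) 0 j).
Proof.
move=> Minj.
(* The value of P (i, j) at z is the difference of the exponents i and j on
   the one-parameter subgroup with exponents z ^ k. *)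
pose P (ij : 'I_N * 'I_N) := rVpoly (col ij.1 M - col ij.2 M)^T.
have P0 ij : ij.1 != ij.2 -> P ij != 0.
  apply: contraNneq => /(congr1 (poly_rV (d := d))); rewrite rVpolyK linear0.
  by move/(congr1 trmx); rewrite trmxK trmx0 => /eqP; rewrite subr_eq0 => /eqP /Minj ->.
have : \prod_(ij : 'I_N * 'I_N | ij.1 != ij.2) P ij != 0.
  by apply/prodf_neq0 => ij; apply: P0.
case/int_poly_nonroot => z; rewrite horner_prod => /prodf_neq0 Pz.
exists (\row_k z ^+ k) => i j /= bij; apply/eqP/negPn/negP => ij.
move: (Pz (i, j) ij); rewrite horner_poly => /eqP; apply.
move: bij => /eqP; rewrite -subr_eq0 !mxE -sumrB => /eqP e; apply: (etrans _ e).
by apply: eq_bigr => k _; rewrite valK !mxE mulrBl mulrC [_ * M k j]mulrC.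
Qed.

Lemma lagrange_basis (K : fieldType) N (lam : 'I_N -> K) : injective lam ->
  forall j, exists p : {poly K}, forall i, p.[lam i] = (i == j)%:R.
Proof.
move=> inj j; set q := \prod_(i | i != j) ('X - (lam i)%:P).
have qE x : q.[x] = \prod_(i | i != j) (x - lam i).
  by rewrite horner_prod; apply: eq_bigr => i _; rewrite hornerXsubC.
have q0 : q.[lam j] != 0.
  rewrite qE; apply/prodf_neq0 => i ij.
  by rewrite subr_eq0; apply: contraNneq ij => /inj ->.
exists (q.[lam j]^-1 *: q) => i; rewrite hornerZ; case: (eqVneq i j) => [->|ij].
  by rewrite mulVf.
by rewrite [q.[lam i]]qE (bigD1 i) //= subrr mul0r mulr0.
Qed.

Section GenericPoints.
Variable K : closedFieldType.

Lemma generic_scalar N (m : 'I_N -> int) : injective m ->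
  exists2 x : K, x != 0 & injective (fun j => x ^ m j).
Proof.
move=> minj; pose E := \sum_j `|m j|%N.
(* Shifting by E makes all exponents nonnegative, hence usable in a polynomial. *)
have mE j : m j = (absz (m j + E%:Z))%:Z - E%:Z.
  rewrite gez0_abs ?addrK //.
  have : (`|m j| <= E)%N by rewrite /E (bigD1 j) //= leq_addr.
  by lia.
pose a j := absz (m j + E%:Z).
have ainj : injective a by move=> i j aij; apply: minj; rewrite mE [RHS]mE -/(a i) aij.
pose P := 'X * \prod_(ij : 'I_N * 'I_N | ij.1 != ij.2) ('X^(a ij.1) - 'X^(a ij.2)) : {poly K}.
have : P != 0.
  rewrite mulf_neq0 ?polyX_eq0 //; apply/prodf_neq0 => -[i j] /= ij.
  apply/eqP => /(congr1 (fun p : {poly K} => p`_(a i))) /eqP.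
  rewrite coefB !coefXn eqxx (inj_eq ainj) (negPf ij) coef0 subr0.
  by rewrite oner_eq0.
case/closed_nonrootP => x; rewrite /root hornerM hornerX mulf_eq0 negb_or.
case/andP => x0; rewrite horner_prod => /prodf_neq0 Px.
exists x => // i j /= xij; apply/eqP/negPn/negP => ij.
move: (Px (i, j) ij); rewrite !hornerE subr_eq0 => /eqP; apply.
by move: xij; rewrite mE [m j]mE !expfzDr // => /mulIf; apply; apply: expfz_neq0.
Qed.

Lemma generic_point d N (M : 'M[int]_(d, N)) :
  injective (fun j => col j M) ->
  exists2 u : 'rV[K]_d, nonzero_row u & injective (fun j => monomials u M 0 j).
Proof.
case/separating_coweight => b /generic_scalar [x x0 xinj].
exists (\row_i x ^ b 0 i) => [i|i j /= e]; first by rewrite mxE expfz_neq0.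
apply: xinj; move: e; rewrite !mxE !expz_sum //.
under eq_bigr do rewrite mxE exprz_exp.
by under [X in _ = X -> _]eq_bigr do rewrite mxE exprz_exp.
Qed.

(** At a generic point u the characters take distinct values; applying the
    hypothesis to the powers of u gives a Vandermonde system for the C j, which
    Lagrange interpolation solves. *)
Lemma monomials_independent d N n (M : 'M[int]_(d, N)) (C : 'I_N -> 'M[K]_n) :
  injective (fun j => col j M) ->
  (forall u, nonzero_row u -> \sum_j monomials u M 0 j *: C j = 0) ->
  forall j, C j = 0.
Proof.
move=> /generic_point [u u0 uinj] C0 j.
have [p pE] := lagrange_basis uinj j.
have Cpow s : \sum_i monomials u M 0 i ^+ s *: C i = 0.
  rewrite -[RHS](C0 (\row_i u 0 i ^ s)); last by move=> i; rewrite mxE expfz_neq0.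
  by rewrite monomials_pow; apply: eq_bigr => i _; rewrite [in RHS]mxE.
transitivity (\sum_i p.[monomials u M 0 i] *: C i).
  rewrite (bigD1 j) //= pE eqxx scale1r big1 ?addr0 // => i ij.
  by rewrite pE (negPf ij) scale0r.
under eq_bigr do rewrite horner_coef scaler_suml.
rewrite exchange_big big1 //= => s _.
under eq_bigr do rewrite -scalerA.
by rewrite -scaler_sumr Cpow scaler0.
Qed.

End GenericPoints.

(** * Orthogonal idempotents *)

Section Resolutions.
Variables (K : fieldType) (n : nat).

Definition resolution (I : finType) (B : I -> 'M[K]_n) : Prop :=
  (forall i j, B i *m B j = if i == j then B i else 0) /\ \sum_i B i = 1%:M.

Definition toral_point N (B : 'I_N -> 'M[K]_n) (lam : 'rV[K]_N) : 'M[K]_n :=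
  \sum_j lam 0 j *: B j.

Lemma nonzero_reindex (I : finType) (C : I -> 'M[K]_n) :
  exists N (h : 'I_N -> I), [/\ injective h, forall j, C (h j) != 0 &
    forall a : I -> K, \sum_i a i *: C i = \sum_j a (h j) *: C (h j)].
Proof.
set A := [set i | C i != 0]%SET.
exists #|A|, (fun j => enum_val j); split => [|j|a]; first exact: enum_val_inj.
  by have := enum_valP j; rewrite inE.
rewrite (bigID (mem A)) /= [X in _ + X]big1 ?addr0 => [|i]; last first.
  by rewrite inE negbK => /eqP ->; rewrite scaler0.
by rewrite big_enum_val.
Qed.

Section Points.
Variables (N : nat) (B : 'I_N -> 'M[K]_n).
Hypothesis resB : resolution B.
Implicit Types (lam mu : 'rV[K]_N) (y : 'M[K]_n).

Lemma toral_point_mull lam j : toral_point B lam *m B j = lam 0 j *: B j.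
Proof.
rewrite mulmx_suml (bigD1 j) //= -scalemxAl resB.1 eqxx big1 ?addr0 // => i ij.
by rewrite -scalemxAl resB.1 (negPf ij) scaler0.
Qed.

Lemma toral_point_mulr lam j : B j *m toral_point B lam = lam 0 j *: B j.
Proof.
rewrite mulmx_sumr (bigD1 j) //= -scalemxAr resB.1 eqxx big1 ?addr0 // => i ij.
by rewrite -scalemxAr resB.1 eq_sym (negPf ij) scaler0.
Qed.

Lemma toral_pointM lam mu :
  toral_point B lam *m toral_point B mu = toral_point B (row_mul lam mu).
Proof.
rewrite {2}/toral_point mulmx_sumr; apply: eq_bigr => j _.
by rewrite -scalemxAr toral_point_mull scalerA mxE mulrC.
Qed.

Lemma toral_point1 : toral_point B (const_mx 1) = 1%:M.
Proof. by rewrite -resB.2; apply: eq_bigr => j _; rewrite mxE scale1r. Qed.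

Lemma toral_pointV lam : nonzero_row lam ->
  toral_point B lam *m toral_point B (\row_j (lam 0 j)^-1) = 1%:M.
Proof.
move=> l0; rewrite toral_pointM -toral_point1; congr toral_point.
by apply/rowP => j; rewrite !mxE mulfV.
Qed.

Lemma toral_point_unit lam : nonzero_row lam -> toral_point B lam \in unitmx.
Proof. by move/toral_pointV/mulmx1_unit => []. Qed.

Lemma invmx_toral_point lam : nonzero_row lam ->
  invmx (toral_point B lam) = toral_point B (\row_j (lam 0 j)^-1).
Proof.
move=> l0; have u := toral_point_unit l0.
by rewrite -[RHS]mul1mx -(mulVmx u) -mulmxA toral_pointV // mulmx1.
Qed.

(** A matrix with distinct eigenvalues lam on the B j determines the B j, so
    commuting with it means commuting with each of them. *)
Lemma toral_point_comm lam : injective (fun j => lam 0 j) ->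
  forall y, y *m toral_point B lam = toral_point B lam *m y ->
  forall mu, y *m toral_point B mu = toral_point B mu *m y.
Proof.
move=> linj y yl.
have off i j : i != j -> B i *m y *m B j = 0.
  move=> ij; have : lam 0 i *: (B i *m y *m B j) = lam 0 j *: (B i *m y *m B j).
    rewrite !scalemxAl -toral_point_mulr -[_ *m _ *m y]mulmxA -yl.
    by rewrite -!mulmxA toral_point_mull -!scalemxAl -!scalemxAr.
  move/eqP; rewrite -subr_eq0 -scalerBl scaler_eq0 subr_eq0 => /orP[/eqP /linj e|/eqP //].
  by rewrite e eqxx in ij.
have yB j : y *m B j = B j *m y.
  transitivity (B j *m y *m B j).
    rewrite -[y *m _]mul1mx -resB.2 mulmx_suml (bigD1 j) //= big1 ?addr0 ?mulmxA //.
    by move=> i ij; rewrite mulmxA off.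
  rewrite -[RHS]mulmx1 -resB.2 mulmx_sumr (bigD1 j) //= big1 ?addr0 ?mulmxA //.
  by move=> i ij; rewrite off // eq_sym.
move=> mu; rewrite mulmx_sumr mulmx_suml; apply: eq_bigr => j _.
by rewrite -scalemxAr yB scalemxAl.
Qed.

(** This leaves finitely many conjugates of a given toral point among the toral
    points, which is what rigidity needs. *)
Lemma conj_eigenvalues lam mu y : (forall j, B j != 0) -> y \in unitmx ->
  y *m toral_point B lam *m invmx y = toral_point B mu ->
  forall j, exists i, mu 0 j = lam 0 i.
Proof.
move=> B0 uy e j; apply: contrapT => nex; move/negP: (B0 j); apply; apply/eqP.
have ye : y *m toral_point B lam = toral_point B mu *m y by rewrite -e mulmxKV.
suff BC i : B i *m invmx y *m B j = 0.
  rewrite -[B j]mul1mx -(mulmxV uy) -mulmxA -[invmx y]mul1mx -resB.2 mulmx_suml.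
  by rewrite mulmx_suml big1 ?mulmx0.
have : lam 0 i *: (B i *m invmx y *m B j) = mu 0 j *: (B i *m invmx y *m B j).
  transitivity (B i *m toral_point B lam *m invmx y *m B j).
    by rewrite toral_point_mulr !scalemxAl.
  rewrite scalemxAr -toral_point_mull -e !mulmxA.
  by rewrite -[_ *m invmx y *m y]mulmxA mulVmx ?mulmx1.
move/eqP; rewrite -subr_eq0 -scalerBl scaler_eq0 subr_eq0 => /orP[/eqP le|/eqP //].
by case: nex; exists i.
Qed.

End Points.
End Resolutions.

Section Laurent.
Variables (K : closedFieldType) (n : nat).

(** Comparing coefficients of v in F (u v) = F u *m F v shows that F u acts on
    C j by the character w j; comparing coefficients of u next shows that the
    C j are orthogonal idempotents. *)
Lemma multiplicative_laurent (I : finType) d (w : I -> 'cV[int]_d)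
    (C : I -> 'M[K]_n) (F := fun u => \sum_i monomials u (w i) 0 0 *: C i) :
  injective w -> F (const_mx 1) = 1%:M ->
  (forall u v, nonzero_row u -> nonzero_row v -> F (row_mul u v) = F u *m F v) ->
  exists N (B : 'I_N -> 'M[K]_n) (M : 'M[int]_(d, N)),
    [/\ resolution B, forall j, B j != 0, injective (fun j => col j M) &
        forall u, F u = toral_point B (monomials u M)].
Proof.
move=> winj F1 FM; have [N [h [hinj C0 sumE]]] := nonzero_reindex C.
pose M := \matrix_(i, j) w (h j) i 0.
have colM j : col j M = w (h j) by apply/colP => i; rewrite !mxE.
have Minj : injective (fun j => col j M) by move=> i j /=; rewrite !colM => /winj /hinj.
have FE u : F u = toral_point (C \o h) (monomials u M).
  rewrite /F sumE; apply: eq_bigr => j _; congr (_ *: _); rewrite !mxE.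
  by apply: eq_bigr => i _; rewrite mxE.
exists N, (C \o h), M; split => //.
(* Coefficients of the character j in the variable v. *)
have FC u j : nonzero_row u -> F u *m C (h j) = monomials u M 0 j *: C (h j).
  move=> u0; apply/eqP; rewrite -subr_eq0; apply/eqP; move: j.
  apply: (monomials_independent Minj) => v v0.
  under eq_bigr do rewrite scalerBr scalemxAr scalerA.
  rewrite sumrB -mulmx_sumr -[X in F u *m X]FE -FM // FE monomials_mul.
  apply/eqP; rewrite subr_eq0; apply/eqP.
  by apply: eq_bigr => j _; rewrite mxE mulrC.
split; last first.
  rewrite -F1 FE monomials_const1; apply: eq_bigr => j _.
  by rewrite mxE scale1r.
move=> i j; apply/eqP; rewrite -subr_eq0; apply/eqP; move: i.
apply: (monomials_independent Minj) => u u0.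
under eq_bigr do rewrite scalerBr scalemxAl.
rewrite sumrB -mulmx_suml -[X in X *m _]FE FC // (bigD1 j) //= eqxx big1 ?addr0 ?subrr //.
by move=> i ij; rewrite (negPf ij) scaler0.
Qed.

End Laurent.

(** * Regular functions and closed subsets of the general linear group *)

Section RegularFunctions.
Variables (K : fieldType) (n : nat).

Definition regular_on (H : set 'M[K]_n) (f : 'M[K]_n -> K) : Prop :=
  exists (p : mpoly (n * n) K) (e : nat),
    forall g, H g -> f g = mx_eval p g / \det g ^+ e.

(** The matrix of the coordinate functions, from which the polynomials giving
    the determinant and the adjugate are read off. *)
Definition generic_mx : 'M[mpoly (n * n) K]_n :=
  \matrix_(i, j) mpolyX K (mnm1 (mxvec_index i j)).

Lemma generic_mxE (g : 'M[K]_n) : map_mx (meval (mxvec g 0)) generic_mx = g.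
Proof. by apply/matrixP => i j; rewrite !mxE mevalXU mxvecE. Qed.

Lemma mx_eval_det (g : 'M[K]_n) : mx_eval (\det generic_mx) g = \det g.
Proof. by rewrite -[in RHS](generic_mxE g) det_map_mx. Qed.

Lemma mx_eval_adj (g : 'M[K]_n) i j : mx_eval ((\adj generic_mx) i j) g = (\adj g) i j.
Proof. by rewrite -[in RHS](generic_mxE g) -map_mx_adj [RHS]mxE. Qed.

Section Arithmetic.
Variable H : set 'M[K]_n.
Hypothesis HGL : H `<=` @GL K n.

Lemma det_neq0 g : H g -> \det g != 0.
Proof. by move=> /HGL; rewrite /GL /= unitmxE unitfE. Qed.

Lemma regular_on_ext f f' : (forall g, H g -> f g = f' g) ->
  regular_on H f -> regular_on H f'.
Proof. by move=> ff' [p [e pE]]; exists p, e => g Hg; rewrite -ff' // pE. Qed.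

(** Denominators can be enlarged at will; this is what makes a common
    denominator possible. *)
Lemma regular_on_widen f : regular_on H f -> exists e0, forall e, (e0 <= e)%N ->
  exists p : mpoly (n * n) K, forall g, H g -> f g = mx_eval p g / \det g ^+ e.
Proof.
move=> [p [e0 pE]]; exists e0 => e le; exists (p * \det generic_mx ^+ (e - e0)) => g Hg.
rewrite pE // /mx_eval mevalM rmorphXn /= -/(mx_eval _ g) -/(mx_eval _ g) mx_eval_det.
have d0 := det_neq0 Hg; rewrite -{2}(subnK le) exprD invfM mulrA.
by rewrite -[_ * _ / _ ^+ (e - e0)]mulrA mulfV ?mulr1 ?expf_neq0.
Qed.

Lemma regular_on_poly (p : mpoly (n * n) K) : regular_on H (mx_eval p).
Proof. by exists p, 0%N => g _; rewrite expr0 divr1. Qed.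

Lemma regular_on_const c : regular_on H (fun=> c).
Proof.
apply: regular_on_ext (regular_on_poly (mpolyC _ c)) => g _.
by rewrite /mx_eval mevalC.
Qed.

Lemma regular_on_entry i j : regular_on H (fun g => g i j).
Proof.
apply: regular_on_ext (regular_on_poly (generic_mx i j)) => g _.
by rewrite -[in RHS](generic_mxE g) [RHS]mxE.
Qed.

Lemma regular_on_invmx i j : regular_on H (fun g => invmx g i j).
Proof.
exists ((\adj generic_mx) i j), 1%N => g Hg; rewrite mx_eval_adj expr1.
by rewrite /invmx (HGL Hg) mxE mulrC.
Qed.

Lemma regular_onD f f' : regular_on H f -> regular_on H f' ->
  regular_on H (fun g => f g + f' g).
Proof.
move=> /regular_on_widen [e fE] /regular_on_widen [e' fE'].
have [p pE] := fE _ (leq_maxl e e'); have [p' pE'] := fE' _ (leq_maxr e e').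
exists (p + p'), (maxn e e') => g Hg.
by rewrite pE // pE' // -mulrDl /mx_eval mevalD.
Qed.

Lemma regular_onM f f' : regular_on H f -> regular_on H f' ->
  regular_on H (fun g => f g * f' g).
Proof.
move=> [p [e pE]] [p' [e' pE']]; exists (p * p'), (e + e')%N => g Hg.
by rewrite pE // pE' // /mx_eval mevalM exprD mulf_div.
Qed.

Lemma regular_on_sum (I : Type) (r : seq I) (f : I -> 'M[K]_n -> K) :
  (forall i, regular_on H (f i)) -> regular_on H (fun g => \sum_(i <- r) f i g).
Proof.
move=> fr; elim: r => [|i r IH].
  by apply: regular_on_ext (regular_on_const 0) => g _; rewrite big_nil.
by apply: regular_on_ext (regular_onD (fr i) IH) => g _; rewrite big_cons.
Qed.

Lemma regular_on_prod (I : Type) (r : seq I) (f : I -> 'M[K]_n -> K) :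
  (forall i, regular_on H (f i)) -> regular_on H (fun g => \prod_(i <- r) f i g).
Proof.
move=> fr; elim: r => [|i r IH].
  by apply: regular_on_ext (regular_on_const 1) => g _; rewrite big_nil.
by apply: regular_on_ext (regular_onM (fr i) IH) => g _; rewrite big_cons.
Qed.

Lemma regular_onX f k : regular_on H f -> regular_on H (fun g => f g ^+ k).
Proof.
move=> fr; have := regular_on_prod (iota 0 k) (fun=> fr).
by apply: regular_on_ext => g _; rewrite big_const_seq count_predT size_iota iter_mulr_1.
Qed.

Lemma regular_onXz f z : regular_on H f -> regular_on H (fun g => (f g)^-1) ->
  regular_on H (fun g => f g ^ z).
Proof.
move=> fr fVr; case: z => k; first exact: regular_onX.
by apply: regular_on_ext (regular_onX k.+1 fVr) => g _; rewrite NegzE -exprz_inv.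
Qed.

Lemma regular_on_mulmx a b c (F : 'M[K]_n -> 'M[K]_(a, b)) (F' : 'M[K]_n -> 'M[K]_(b, c)) :
  (forall i j, regular_on H (fun g => F g i j)) ->
  (forall i j, regular_on H (fun g => F' g i j)) ->
  forall i j, regular_on H (fun g => (F g *m F' g) i j).
Proof.
move=> Fr Fr' i j; apply: regular_on_ext (_ : regular_on H (fun g => \sum_k F g i k * F' g k j)).
  by move=> g _; rewrite mxE.
by apply: regular_on_sum => k; apply: regular_onM.
Qed.

Lemma regular_on_comp m (F : 'M[K]_n -> 'M[K]_m) (p : mpoly (m * m) K) :
  (forall i j, regular_on H (fun g => F g i j)) ->
  regular_on H (fun g => mx_eval p (F g)).
Proof.
move=> Fr; apply: regular_on_ext (_ : regular_on H (fun g =>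
    \sum_(x <- msupp p) mcoeff x p * \prod_k mxvec (F g) 0 k ^+ x k)).
  by move=> g _; rewrite /mx_eval mevalE.
apply: regular_on_sum => x; apply: regular_onM; first exact: regular_on_const.
apply: regular_on_prod => k; apply: regular_onX; case/mxvec_indexP: k => i j.
by apply: regular_on_ext (Fr i j) => g _; rewrite mxvecE.
Qed.

Lemma regular_mapP m (F : 'M[K]_n -> 'M[K]_m) :
  regular_map H F <-> forall i j, regular_on H (fun g => F g i j).
Proof.
split=> [[P [e PE]] i j|Fr]; first by exists (P i j), e => g Hg; apply: PE.
have /choice [e0 eE] : forall ij : 'I_m * 'I_m, exists e0, forall e, (e0 <= e)%N ->
    exists p : mpoly (n * n) K, forall g, H g -> F g ij.1 ij.2 = mx_eval p g / \det g ^+ e.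
  by move=> [i j]; apply: regular_on_widen.
pose e := \max_ij e0 ij.
have /choice [P PE] : forall ij : 'I_m * 'I_m, exists p : mpoly (n * n) K,
    forall g, H g -> F g ij.1 ij.2 = mx_eval p g / \det g ^+ e.
  by move=> ij; apply: eE; apply: leq_bigmax.
by exists (fun i j => P (i, j)), e => g Hg i j; apply: (PE (i, j)).
Qed.

End Arithmetic.

(** Sets closed in GL_n but not necessarily in the space of all matrices. *)
Definition gl_closed (H : set 'M[K]_n) : Prop :=
  exists2 C : set (zariski K n), closed C & H = @GL K n `&` C.

Lemma gl_closedP (H : set 'M[K]_n) :
  gl_closed H <-> exists P, H = @GL K n `&` zeros P.
Proof.
split=> [[C Ccl ->]|[P ->]]; last first.
  by exists (zeros P) => //; rewrite -openC; exists P.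
have [P CE] : zariski_open (~` C) by have := Ccl; rewrite -openC.
by exists P; rewrite -[C]setCK CE setCK.
Qed.

Lemma gl_closedT : gl_closed (@GL K n).
Proof. by exists setT; [apply: closedT | rewrite setIT]. Qed.

Lemma gl_closedGL H : gl_closed H -> H `<=` @GL K n.
Proof. by move=> [C _ ->] g []. Qed.

Lemma gl_closed_zeros (I : Type) (H : set 'M[K]_n) (f : I -> 'M[K]_n -> K) :
  gl_closed H -> (forall i, regular_on H (f i)) ->
  gl_closed [set g | H g /\ forall i, f i g = 0].
Proof.
move=> Hcl fr; have HGL := gl_closedGL Hcl.
have [Q HE] := (gl_closedP H).1 Hcl.
have /choice [p pE] := fr; apply/gl_closedP.
have fp i g : H g -> (f i g = 0 <-> mx_eval (p i) g = 0).
  move=> Hg; have [e ->] := pE i; last by [].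
  split=> [/eqP|->]; last by rewrite mul0r.
  by rewrite mulf_eq0 invr_eq0 expf_eq0 (negPf (det_neq0 HGL Hg)) andbF orbF => /eqP.
exists (Q `|` range p); apply/seteqP; split => g /= [].
  move=> Hg fg; have := Hg; rewrite HE => -[GLg Qg]; split=> // q [/Qg //|[i _ <-]].
  by apply/fp.
move=> GLg Zg; have Hg : H g by rewrite HE; split=> // q Qq; apply: Zg; left.
by split=> // i; apply/fp => //; apply: Zg; right; exists i.
Qed.

Lemma closure_gl_closed (X Z : set 'M[K]_n) : gl_closed Z -> X `<=` Z ->
  @GL K n `&` closure (X : set (zariski K n)) `<=` Z.
Proof.
move=> [C Ccl ->] XZ g [GLg Xg]; split=> //.
by apply: Ccl; apply: closureS Xg => x /XZ [].
Qed.

End RegularFunctions.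

Lemma gl_closed_preimage (K : fieldType) n m (H : set 'M[K]_n) (Z : set 'M[K]_m)
    (F : 'M[K]_n -> 'M[K]_m) :
  gl_closed H -> gl_closed Z -> (forall g, H g -> GL (F g)) ->
  (forall i j, regular_on H (fun g => F g i j)) ->
  gl_closed [set g | H g /\ Z (F g)].
Proof.
move=> Hcl /gl_closedP [P ->] FGL Fr; have HGL := gl_closedGL Hcl.
rewrite (_ : mkset _ = [set g | H g /\ forall p : {p | P p}, mx_eval (sval p) (F g) = 0]).
  by apply: gl_closed_zeros => // -[p Pp]; apply: regular_on_comp.
apply/seteqP; split => g /= [Hg].
  by move=> [_ Zg]; split=> // -[p Pp]; apply: Zg.
by move=> Zg; do 2!split=> //; [apply: FGL | move=> p Pp; apply: (Zg (exist _ p Pp))].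
Qed.

(** * Tori as sets of toral points *)

Section ToralSets.
Variables (K : closedFieldType) (n : nat).

Definition toral_set d N (B : 'I_N -> 'M[K]_n) (M : 'M[int]_(d, N)) : set 'M[K]_n :=
  [set toral_point B (monomials u M) | u in @nonzero_row K d].

Lemma diag_groupE d (u : 'rV[K]_d) : @diag_group K d (diag_mx u) <-> nonzero_row u.
Proof.
rewrite /diag_group /= unitmxE det_diag unitfE; split=> [[/prodf_neq0 u0 _] i|u0].
  exact: u0.
by split; [apply/prodf_neq0 => i _; apply: u0 | apply: diag_mx_is_diag].
Qed.

Lemma diag_groupP d (g : 'M[K]_d) : diag_group g -> exists2 u, nonzero_row u & g = diag_mx u.
Proof.
move=> gd; have [_ /diag_mxP [u gE]] := gd.
by exists u => //; apply/diag_groupE; rewrite -gE.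
Qed.

Lemma diag_mxM d (u v : 'rV[K]_d) : diag_mx u *m diag_mx v = diag_mx (row_mul u v).
Proof. by rewrite mulmx_diag. Qed.

(** On a diagonal matrix the off-diagonal coordinates vanish and the
    determinant is the product of the entries, so a regular function becomes a
    polynomial divided by a monomial. *)
Lemma regular_map_laurent d (F : 'M[K]_d -> 'M[K]_n) :
  regular_map (@diag_group K d) F ->
  exists (I : finType) (w : I -> 'cV[int]_d) (C : I -> 'M[K]_n), injective w /\
    forall u, nonzero_row u -> F (diag_mx u) = \sum_i monomials u (w i) 0 0 *: C i.
Proof.
move=> [P [e PE]].
(* Substituting the generic diagonal matrix makes the P i j polynomials in d
   variables; subtracting e from all exponents accounts for the determinant. *)
pose D : 'M[mpoly d K]_d := \matrix_(a, b) (if a == b then mpolyX K (mnm1 a) else 0).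
pose q i j := comp_mpoly [tuple mxvec D 0 k | k < d * d] (P i j).
have qE i j (u : 'rV[K]_d) : meval (u 0) (q i j) = mx_eval (P i j) (diag_mx u).
  rewrite comp_mpoly_meval; apply: meval_eq => l; rewrite tnth_mktuple.
  case/mxvec_indexP: l => a b; rewrite !mxvecE !mxE.
  by case: (eqVneq a b) => [->|_]; rewrite ?mevalXU ?meval0 ?mulr1n ?mulr0n.
pose k := \max_(ij : 'I_n * 'I_n) msize (q ij.1 ij.2).
exists (bmultinom d k), (fun m : bmultinom d k => \col_i ((m i)%:Z - e%:Z)),
  (fun m : bmultinom d k => \matrix_(i, j) mcoeff m (q i j)); split=> [m m' mm'|u u0].
  apply/val_inj/mnmP => i; move/colP/(_ i): mm'.
  by rewrite !mxE => /addIr [].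
apply/matrixP => i j; rewrite (PE _ ((diag_groupE u).2 u0)) -qE det_diag summxE.
rewrite (mpolywE (k := k) (p := q i j)); last exact: (leq_bigmax (i, j)).
rewrite (raddf_sum (meval (u 0))) mulr_suml; apply: eq_bigr => m _.
rewrite /= mevalZ mevalX !mxE -mulrA mulrC; congr (_ * _).
rewrite -prodrXl -prodf_div; apply: eq_bigr => a _.
by rewrite mxE expfzDr ?u0 // -invr_expz.
Qed.

(** The inverse of an isomorphism from D to a diagonal group is a matrix-valued
    Laurent polynomial, and it is multiplicative. *)
Lemma torus_toral (D : set 'M[K]_n) : torus D ->
  exists d N (B : 'I_N -> 'M[K]_n) (M : 'M[int]_(d, N)),
    [/\ resolution B, forall j, B j != 0, injective (fun j => col j M) &
        D = toral_set B M].
Proof.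
move=> [[[DGL _ _ _] _] [d [f [f' [[_ fD _] [f'reg f'D f'M] ff' _]]]]].
have [I [w [C [winj FE]]]] := regular_map_laurent f'reg.
have nz1 : nonzero_row (const_mx 1 : 'rV[K]_d) by move=> i; rewrite mxE oner_neq0.
have [||N [B [M [resB B0 Minj FB]]]] := multiplicative_laurent (C := C) winj.
- rewrite -FE // diag_const_mx; have d1 : @diag_group K d 1%:M.
    by rewrite -diag_const_mx; apply/diag_groupE.
  have u1 := DGL _ (f'D _ d1).
  by have := f'M _ _ d1 d1; rewrite mulmx1 => /(congr1 (mulmx (invmx (f' 1%:M)))); rewrite mulKmx // mulVmx.
- move=> u v u0 v0; rewrite -!FE //; last exact: row_mul_neq0.
  by rewrite -diag_mxM f'M //; apply/diag_groupE.
exists d, N, B, M; split=> //; apply/seteqP; split => [g Dg|_ [u u0 <-]].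
  have [u u0 fg] := diag_groupP (fD _ Dg).
  by exists u => //; rewrite -FB -FE // -fg ff'.
by rewrite -FB -FE //; apply/f'D/diag_groupE.
Qed.

Lemma exists_nthroot c (w : K) : (0 < c)%N -> exists z, z ^+ c = w.
Proof.
move=> c0; have /closed_rootP [z] : size ('X^c - w%:P : {poly K}) != 1%N.
  by rewrite size_XnsubC // eqSS -lt0n.
by rewrite /root !hornerE subr_eq0 => /eqP; exists z.
Qed.

Lemma exists_row_root c d (w : 'rV[K]_d) : (0 < c)%N -> nonzero_row w ->
  exists2 z, nonzero_row z & \row_i (z 0 i ^ c) = w.
Proof.
move=> c0 w0; have /choice [z zE] := fun i => exists_nthroot (w 0 i) c0.
exists (\row_i z i) => [i|]; last by apply/rowP => i; rewrite !mxE -[RHS]zE.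
by apply: contraNneq (w0 i) => zi; rewrite -zE; rewrite mxE in zi; rewrite zi expr0n eqn0Ngt c0 eqxx.
Qed.

Section Regularity.
Variables (m : nat) (H : set 'M[K]_m) (HGL : H `<=` @GL K m).

Lemma regular_on_monomials d N (E : 'M[K]_m -> 'rV[K]_d) (M : 'M[int]_(d, N)) :
  (forall i, regular_on H (fun x => E x 0 i)) ->
  (forall i, regular_on H (fun x => (E x 0 i)^-1)) ->
  forall j, regular_on H (fun x => monomials (E x) M 0 j).
Proof.
move=> Er EVr j; apply: (regular_on_ext (f := fun x => \prod_i E x 0 i ^ M i j)).
  by move=> x _; rewrite mxE.
by apply: regular_on_prod => // i; apply: regular_onXz.
Qed.

Lemma regular_on_monomialsV d N (E : 'M[K]_m -> 'rV[K]_d) (M : 'M[int]_(d, N)) :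
  (forall i, regular_on H (fun x => E x 0 i)) ->
  (forall i, regular_on H (fun x => (E x 0 i)^-1)) ->
  forall j, regular_on H (fun x => (monomials (E x) M 0 j)^-1).
Proof.
move=> Er EVr j; have := regular_on_monomials (- M) Er EVr j.
apply: regular_on_ext => x _; rewrite !mxE -prodfV.
by apply: eq_bigr => i _; rewrite mxE invr_expz.
Qed.

Lemma regular_on_toral_point N (B : 'I_N -> 'M[K]_n) (E : 'M[K]_m -> 'rV[K]_N) :
  (forall j, regular_on H (fun x => E x 0 j)) ->
  forall a b, regular_on H (fun x => toral_point B (E x) a b).
Proof.
move=> Er a b; apply: (regular_on_ext (f := fun x => \sum_j E x 0 j * B j a b)).
  by move=> x _; rewrite summxE; apply: eq_bigr => j _; rewrite mxE.
apply: regular_on_sum => // j; apply: regular_onM => //; exact: regular_on_const.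
Qed.

End Regularity.

Lemma toral_set_subgroup d N (B : 'I_N -> 'M[K]_n) (M : 'M[int]_(d, N)) :
  resolution B -> subgroup (toral_set B M).
Proof.
move=> resB; split.
- by move=> _ [u u0 <-]; apply: toral_point_unit => //; apply: monomials_neq0.
- exists (const_mx 1); first by move=> i; rewrite mxE oner_neq0.
  by rewrite monomials_const1 toral_point1.
- move=> _ _ [u u0 <-] [v v0 <-]; exists (row_mul u v); first exact: row_mul_neq0.
  by rewrite monomials_mul toral_pointM.
- move=> _ [u u0 <-]; exists (\row_i (u 0 i ^ (-1))).
    by move=> i; rewrite mxE expfz_neq0.
  rewrite monomials_pow (invmx_toral_point resB (monomials_neq0 M u0)).
  by congr toral_point; apply/rowP => j; rewrite [LHS]mxE [RHS]mxE exprN1.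
Qed.

(** The eigenvalues of a toral point on the B j are linear functions of it, and
    the monomials with exponents V' recover the parameter from the eigenvalues.
    This gives the regular inverse of the parametrization, and also the
    equations of the set: x is in it iff the parametrization, applied to the
    parameter recovered from x, gives x back. *)
Lemma split_toral_set_torus r N (B : 'I_N -> 'M[K]_n) (V : 'M[int]_(r, N))
    (V' : 'M[int]_(N, r)) :
  resolution B -> (forall j, B j != 0) -> V *m V' = 1%:M -> torus (toral_set B V).
Proof.
move=> resB B0 VV'; set D := toral_set B V.
have /choice [ab abE] : forall j, exists ab : 'I_n * 'I_n, B j ab.1 ab.2 != 0.
  move=> j; apply: contrapT => nex; case/eqP: (B0 j); apply/matrixP => a b.
  by rewrite [RHS]mxE; apply: contrapT => /eqP ne; apply: nex; exists (a, b).
pose coord (x : 'M[K]_n) : 'rV[K]_N :=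
  \row_j ((B j *m x) (ab j).1 (ab j).2 / B j (ab j).1 (ab j).2).
have coordE lam : coord (toral_point B lam) = lam.
  by apply/rowP => j; rewrite mxE toral_point_mulr // mxE mulfK.
have coordr (H : set 'M[K]_n) (F : 'M[K]_n -> 'M[K]_n) : H `<=` @GL K n ->
    (forall i j, regular_on H (fun x => F x i j)) ->
    forall j, regular_on H (fun x => coord (F x) 0 j).
  move=> HGL Fr j; apply: (regular_on_ext (f := fun x =>
    (B j *m F x) (ab j).1 (ab j).2 * (B j (ab j).1 (ab j).2)^-1)).
    by move=> x _; rewrite [RHS]mxE.
  apply: regular_onM => //; last exact: regular_on_const.
  by apply: regular_on_mulmx => // a b; apply: regular_on_const.
(* On H the coordinates are invertible with regular inverses, so negative
   exponents make sense there. *)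
pose H := [set x | @GL K n x /\ forall j, coord x 0 j * coord (invmx x) 0 j - 1 = 0].
have Hcl : gl_closed H.
  apply: gl_closed_zeros; first exact: gl_closedT.
  move=> j; apply: regular_onD => //; last exact: regular_on_const.
  apply: regular_onM => //; apply: coordr => // a b; first exact: regular_on_entry.
  exact: regular_on_invmx.
have HGL := gl_closedGL Hcl.
have Hinv x j : H x -> (coord x 0 j)^-1 = coord (invmx x) 0 j.
  move=> [_ /(_ j)/eqP]; rewrite subr_eq0 => /eqP e.
  by apply: (@mulIf _ (coord x 0 j)); rewrite ?mulVf 1?[RHS]mulrC ?e //; apply/eqP => c0; move/eqP: e; rewrite c0 mul0r eq_sym oner_eq0.
have Hnz x : H x -> nonzero_row (coord x).
  move=> [_ Hx] j; apply/eqP => c0; move/eqP: (Hx j).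
  by rewrite c0 mul0r add0r oppr_eq0 oner_eq0.
have cr j : regular_on H (fun x => coord x 0 j).
  by apply: (coordr _ id) => // a b; apply: regular_on_entry.
have cVr j : regular_on H (fun x => (coord x 0 j)^-1).
  apply: (regular_on_ext (f := fun x => coord (invmx x) 0 j)) => [x /Hinv -> //|].
  by apply: coordr => // a b; apply: regular_on_invmx.
pose W x := monomials (coord x) V'.
have Wr i : regular_on H (fun x => W x 0 i) by apply: regular_on_monomials.
have WVr i : regular_on H (fun x => (W x 0 i)^-1) by apply: regular_on_monomialsV.
have Wnz x : H x -> nonzero_row (W x) by move=> /Hnz; apply: monomials_neq0.
have DH x : D x -> H x.
  move=> [w w0 <-]; have m0 : nonzero_row (monomials w V) by apply: monomials_neq0.
  split=> [|j]; first exact: toral_point_unit.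
  by rewrite invmx_toral_point // !coordE [X in _ * X]mxE mulfV ?subrr.
have WE w : nonzero_row w -> W (toral_point B (monomials w V)) = w.
  by move=> w0; rewrite /W coordE monomials_comp // VV' monomials_id.
have DGL : D `<=` @GL K n by move=> x /DH /HGL.
have Dgrp : subgroup D by apply: toral_set_subgroup.
split.
  split=> //.
  suff -> : D = [set x | H x /\ forall ij : 'I_n * 'I_n,
      toral_point B (monomials (W x) V) ij.1 ij.2 - x ij.1 ij.2 = 0].
    apply: gl_closed_zeros => // -[i j] /=; apply: regular_onD => //.
      by apply: regular_on_toral_point => // k; apply: regular_on_monomials.
    apply: (regular_on_ext (f := fun x => (-1) * x i j)) => [x _|]; first by rewrite mulN1r.
    by apply: regular_onM => //; [apply: regular_on_const | apply: regular_on_entry].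
  apply/seteqP; split => x.
    move=> Dx; split; first exact: DH.
    by case: Dx => w w0 <- ij; rewrite WE // subrr.
  move=> [Hx xE]; exists (W x); first exact: Wnz.
  by apply/matrixP => i j; apply/eqP; rewrite -subr_eq0; apply/eqP/(xE (i, j)).
exists r, (fun x => diag_mx (W x)), (fun y => toral_point B (monomials (\row_i y i i) V)).
have rowE (w : 'rV[K]_r) : \row_i (diag_mx w) i i = w.
  by apply/rowP => i; rewrite !mxE eqxx mulr1n.
have dGL : @diag_group K r `<=` @GL K r by move=> y [].
split.
- split.
  + apply/regular_mapP => // i j.
    have [p [e pE]] : regular_on H (fun x => diag_mx (W x) i j).
      apply: (regular_on_ext (f := fun x => W x 0 i * (i == j)%:R)).
        by move=> x _; rewrite [RHS]mxE mulr_natr.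
      by apply: regular_onM => //; apply: regular_on_const.
    by exists p, e => x /DH; apply: pE.
  + by move=> x /DH /Wnz Wx; apply/diag_groupE.
  + move=> _ _ [u u0 <-] [v v0 <-]; rewrite toral_pointM // -monomials_mul.
    by rewrite !WE ?diag_mxM //; apply: row_mul_neq0.
- split.
  + apply/regular_mapP => // i j; apply: regular_on_toral_point => // k.
    apply: regular_on_monomials => // l.
      apply: (regular_on_ext (f := fun y : 'M[K]_r => y l l)) => [y _|]; first by rewrite mxE.
      exact: regular_on_entry.
    apply: (regular_on_ext (f := fun y : 'M[K]_r => invmx y l l)); last exact: regular_on_invmx.
    move=> y /diag_groupP [w w0 ->]; rewrite !mxE eqxx mulr1n.
    have dw : diag_mx w *m diag_mx (\row_i (w 0 i)^-1) = 1%:M.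
      rewrite mulmx_diag -diag_const_mx; congr diag_mx; apply/rowP => k'.
      by rewrite !mxE mulfV.
    have [uw _] := mulmx1_unit dw.
    by rewrite -[invmx _]mulmx1 -dw mulKmx // !mxE eqxx mulr1n.
  + by move=> y /diag_groupP [w w0 ->]; rewrite rowE; exists w.
  + move=> y y' /diag_groupP [w w0 ->] /diag_groupP [w' w0' ->].
    by rewrite diag_mxM !rowE monomials_mul toral_pointM.
- by move=> _ [w w0 <-]; rewrite WE // rowE.
- by move=> y /diag_groupP [w w0 ->]; rewrite rowE WE.
Qed.

(** Factoring M = Q *m V reduces to the previous lemma, since the monomial map Q
    is onto: roots exist in K. *)
Lemma toral_set_torus d N (B : 'I_N -> 'M[K]_n) (M : 'M[int]_(d, N)) :
  resolution B -> (forall j, B j != 0) -> torus (toral_set B M).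
Proof.
move=> resB B0.
have [r [Q [Q' [V [V' [c [-> VV' Q'Q c0]]]]]]] := int_rank_factorization M.
suff -> : toral_set B (Q *m V) = toral_set B V by apply: split_toral_set_torus VV'.
apply/seteqP; split => _ [u u0 <-].
  by exists (monomials u Q); [apply: monomials_neq0 | rewrite monomials_comp].
have [z z0 zE] := exists_row_root c0 u0.
exists (monomials z Q'); first exact: monomials_neq0.
by rewrite -monomials_comp ?(monomials_comp Q' Q) // ?Q'Q ?monomials_scalar ?zE //; apply: monomials_neq0.
Qed.

End ToralSets.

(** * Rigidity and maximal tori *)

Section Conjugation.
Variables (K : closedFieldType) (n : nat).

Lemma toral_point_delta N (B : 'I_N -> 'M[K]_n) j : toral_point B (delta_mx 0 j) = B j.
Proof.
rewrite /toral_point (bigD1 j) //= mxE !eqxx scale1r big1 ?addr0 // => i ij.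
by rewrite mxE (negPf ij) andbF scale0r.
Qed.

Lemma conj_resolution (I : finType) (B : I -> 'M[K]_n) (g : 'M[K]_n) : g \in unitmx ->
  resolution B -> resolution (fun i => g *m B i *m invmx g).
Proof.
move=> ug [BB B1]; split=> [i j|]; last by rewrite -mulmx_suml -mulmx_sumr B1 mulmx1 mulmxV.
rewrite -!mulmxA mulKmx // [B i *m (B j *m _)]mulmxA BB.
by case: eqP => _; rewrite ?mul0mx ?mulmx0 ?mulmxA.
Qed.

Lemma conj_toral_point N (B : 'I_N -> 'M[K]_n) (g : 'M[K]_n) lam :
  g *m toral_point B lam *m invmx g = toral_point (fun j => g *m B j *m invmx g) lam.
Proof.
rewrite mulmx_sumr mulmx_suml; apply: eq_bigr => j _.
by rewrite -scalemxAr -scalemxAl.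
Qed.

(** Rigidity of tori.  The first torus has an element with distinct
    eigenvalues on the B j; the second torus permutes its conjugates, which are
    finite in number, and being divisible it fixes each of them. *)
Lemma toral_set_centralizes d N (B : 'I_N -> 'M[K]_n) (M : 'M[int]_(d, N))
    d' N' (B' : 'I_N' -> 'M[K]_n) (M' : 'M[int]_(d', N')) :
  resolution B -> (forall j, B j != 0) -> injective (fun j => col j M) ->
  resolution B' ->
  (forall x y, toral_set B M x -> toral_set B' M' y ->
     toral_set B M (y *m x *m invmx y)) ->
  forall lam y, toral_set B' M' y -> y *m toral_point B lam = toral_point B lam *m y.
Proof.
move=> resB B0 Minj resB' norm lam0 _ [u' u'0 <-].
have [u u0 linj] := generic_point K Minj; set lam := monomials u M in linj.
pose T : finType := {ffun 'I_N -> 'I_N}; have c0 := fact_gt0 #|T|.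
have [z z0 zE] := exists_row_root c0 u'0.
pose y (k : nat) := toral_point B' (monomials (\row_i z 0 i ^ k) M').
have yD : toral_set B' M' (y _) by move=> k; exists (\row_i z 0 i ^ k) => // i; rewrite mxE expfz_neq0.
have yu k : y k \in unitmx by have [/(_ _ (yD k))] := toral_set_subgroup M' resB'.
have y_add k l : y (k + l)%N = y k *m y l.
  rewrite toral_pointM // -monomials_mul; congr (toral_point _ (monomials _ _)).
  by apply/rowP => i; rewrite !mxE -expfzDr // PoszD.
have y0 : y 0%N = 1%:M.
  rewrite /y (_ : (\row_i _) = const_mx 1) ?monomials_const1 ?toral_point1 //.
  by apply/rowP => i; rewrite !mxE expr0z.
have /choice [s sE] : forall k, exists s : T,
    y k *m toral_point B lam *m invmx (y k) = toral_point B (\row_j lam 0 (s j)).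
  move=> k; have : toral_set B M (y k *m toral_point B lam *m invmx (y k)).
    by apply: norm => //; exists u.
  case=> v v0 vE; have /choice [s sE] := conj_eigenvalues resB B0 (yu k) (esym vE).
  exists (finfun s); rewrite -vE; congr toral_point; apply/rowP => j.
  by rewrite [RHS]mxE ffunE.
(* Two of the first #|T| + 1 powers of y 1 give the same conjugate, so a power
   y p with p at most #|T| commutes with the generic point. *)
have /injectivePn [k [l kl skl]] : ~~ injectiveb (fun k : 'I_#|T|.+1 => s k).
  by apply/injectiveP => /leq_card; rewrite card_ord ltnn.
wlog lt_kl : k l kl skl / (k < l)%N => [hwlog|].
  case: (ltngtP k l) => [||/val_inj e]; [exact: hwlog | apply: hwlog => //|].
    by rewrite eq_sym.
  by rewrite e eqxx in kl.
pose p := (l - k)%N; have p0 : (0 < p)%N by rewrite subn_gt0.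
have comm_p : y p *m toral_point B lam = toral_point B lam *m y p.
  have lE : (k + p)%N = l by rewrite subnKC // ltnW.
  have := sE l; rewrite -skl -sE -lE.
  move=> /(congr1 (fun X => invmx (y k) *m (X *m y (k + p)%N))).
  by rewrite /= mulmxKV // {1}y_add -!mulmxA mulKmx // y_add !mulKmx.
have comm_q q : y (p * q)%N *m toral_point B lam = toral_point B lam *m y (p * q)%N.
  elim: q => [|q IH]; first by rewrite muln0 y0 mul1mx mulmx1.
  by rewrite mulnS y_add -mulmxA IH !mulmxA comm_p.
(* The given element is y c for c the factorial of #|T|, a multiple of p. *)
have pT : (p %| factorial #|T|)%N.
  by apply: dvdn_fact; rewrite p0 /p leq_subLR (leq_trans _ (leq_addl _ _)) // -ltnS ltn_ord.
apply: (toral_point_comm resB linj); rewrite -zE -/(y _).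
by have := comm_q (factorial #|T| %/ p)%N; rewrite mulnC divnK.
Qed.

(** The products of the two families of idempotents, without the zero ones,
    form a resolution that diagonalizes both sets. *)
Lemma toral_set_product d N (B : 'I_N -> 'M[K]_n) (M : 'M[int]_(d, N))
    d' N' (B' : 'I_N' -> 'M[K]_n) (M' : 'M[int]_(d', N')) :
  resolution B -> resolution B' ->
  (forall i j, B i *m B' j = B' j *m B i) ->
  exists d'' N'' (E : 'I_N'' -> 'M[K]_n) (M'' : 'M[int]_(d'', N'')),
    [/\ resolution E, forall j, E j != 0 &
        toral_set E M'' = [set x *m y | x in toral_set B M & y in toral_set B' M']].
Proof.
move=> resB resB' BB'.
have [N'' [h [hinj h0 sumE]]] := nonzero_reindex (fun kl : 'I_N * 'I_N' => B kl.1 *m B' kl.2).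
(* The weight of B k *m B' l is the weight of B k in the first d parameters
   and that of B' l in the last d'. *)
pose M'' := \matrix_(i, j) col_mx M 0 i (h j).1 + \matrix_(i, j) col_mx 0 M' i (h j).2 : 'M[int]_(d + d', N'').
have sum2 (lam : 'rV[K]_N) (mu : 'rV[K]_N') : toral_point B lam *m toral_point B' mu =
    \sum_kl (lam 0 kl.1 * mu 0 kl.2) *: (B kl.1 *m B' kl.2).
  rewrite mulmx_suml -(pair_bigA _ (fun k l => (lam 0 k * mu 0 l) *: (B k *m B' l))) /=.
  apply: eq_bigr => k _; rewrite mulmx_sumr; apply: eq_bigr => l _.
  by rewrite -scalemxAl -scalemxAr scalerA.
exists (d + d')%N, N'', (fun j => B (h j).1 *m B' (h j).2), M''; split=> //.
  split=> [i j|].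
    rewrite mulmxA -[_ *m _ *m B _]mulmxA -BB' mulmxA resB.1 -mulmxA resB'.1.
    rewrite -(inj_eq hinj) -pair_eqE /pair_eq.
    by do 2!case: eqP => _ //=; rewrite ?mul0mx ?mulmx0.
  have := sumE (fun=> 1); under [X in _ = X -> _]eq_bigr do rewrite scale1r.
  move=> <-; rewrite -[RHS]mulmx1 -{1}(toral_point1 resB) -(toral_point1 resB') sum2.
  by apply: eq_bigr => kl _; rewrite !mxE mulr1.
have EE (u : 'rV[K]_d) (v : 'rV[K]_d') : nonzero_row u -> nonzero_row v ->
    toral_point (fun j => B (h j).1 *m B' (h j).2) (monomials (row_mx u v) M'') =
    toral_point B (monomials u M) *m toral_point B' (monomials v M').
  move=> u0 v0; rewrite sum2 sumE; apply: eq_bigr => j _; congr (_ *: _).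
  rewrite !mxE big_split_ord /=; congr (_ * _); apply: eq_bigr => i _.
    by rewrite row_mxEl !mxE !(unsplitK (inl _)) mxE addr0.
  by rewrite row_mxEr !mxE !(unsplitK (inr _)) mxE add0r.
apply/seteqP; split=> [_ [u u0 <-]|_ [_ [u u0 <-] [_ [v v0 <-] <-]]].
  have u1 : nonzero_row (lsubmx u) by move=> i; rewrite mxE.
  have u2 : nonzero_row (rsubmx u) by move=> i; rewrite mxE.
  exists (toral_point B (monomials (lsubmx u) M)); first by exists (lsubmx u).
  exists (toral_point B' (monomials (rsubmx u) M')); first by exists (rsubmx u).
  by rewrite -EE // hsubmxK.
exists (row_mx u v); last by rewrite EE.
by move=> i; rewrite mxE; case: split.
Qed.

(** By rigidity the conjugate torus commutes with D, so the product of the two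
    is a torus of G containing D, which is D by maximality. *)
Lemma maximal_torus_absorbs (G D : set 'M[K]_n) g :
  subgroup G -> maximal_torus G D -> G g ->
  (forall x y, D x -> D y ->
     let z := g *m y *m invmx g in D (z *m x *m invmx z)) ->
  forall x, D x -> D (g *m x *m invmx g).
Proof.
move=> [GGL _ GM GV] [torD DG Dmax] Gg norm.
have [d [N [B [M [resB B0 Minj DE]]]]] := torus_toral torD.
have ug := GGL _ Gg.
pose Bg j := g *m B j *m invmx g.
have resBg : resolution Bg by apply: conj_resolution.
have comm := @toral_set_centralizes _ _ B M _ _ Bg M resB B0 Minj resBg.
have {}comm lam y : toral_set Bg M y -> y *m toral_point B lam = toral_point B lam *m y.
  apply: comm => {lam y} x _ Dx [u u0 <-]; rewrite -conj_toral_point -DE.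
  by apply: norm; rewrite DE //; exists u.
have [u u0 linj] := generic_point K Minj.
have BBg i j : B i *m Bg j = Bg j *m B i.
  rewrite -[Bg j]toral_point_delta; apply: (toral_point_comm resBg linj).
  by rewrite -[B i]toral_point_delta comm //; exists u.
have [d' [N' [E [M' [resE E0 EE]]]]] := toral_set_product M M resB resBg BBg.
have [_ B1 _ _] := toral_set_subgroup M resB.
have [_ Bg1 _ _] := toral_set_subgroup M resBg.
have ED : toral_set E M' = D.
  apply: Dmax; first exact: toral_set_torus.
    rewrite EE => _ [x Dx [_ [v v0 <-] <-]]; rewrite -conj_toral_point.
    move: Dx; rewrite -DE => Dx; apply: (GM _ _ (DG _ Dx)); apply: (GM _ _ _ (GV _ Gg)).
    by apply: (GM _ _ Gg); apply: DG; rewrite DE; exists v.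
  by move=> x; rewrite DE EE => Dx; exists x => //; exists 1%:M => //; rewrite mulmx1.
move=> x; rewrite {1}DE -ED EE => -[v v0 <-]; exists 1%:M => //.
by rewrite conj_toral_point; exists (toral_point Bg (monomials v M)); [exists v | rewrite mul1mx].
Qed.

End Conjugation.

(** * Integral points *)

Lemma unitmx_conj (F : comUnitRingType) n (g y : 'M[F]_n) :
  g \in unitmx -> y \in unitmx -> g *m y *m invmx g \in unitmx.
Proof. by move=> ug uy; rewrite !unitmx_mul unitmx_inv ug uy. Qed.

Section IntegralPoints.
Variables (R : idomainType) (K : closedFieldType) (n : nat).
Variable phi : {rmorphism R -> K}.

Definition integral_points (D : set 'M[K]_n) : set 'M[R]_n :=
  [set g | GL g /\ D (map_mx phi g)].

Lemma map_mx_GL (g : 'M[R]_n) : GL g -> GL (map_mx phi g).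
Proof. by rewrite /GL /= !unitmxE det_map_mx; apply: rmorph_unit. Qed.

Lemma map_mx_invmx (g : 'M[R]_n) : GL g -> map_mx phi (invmx g) = invmx (map_mx phi g).
Proof.
move=> ug; have ug' := map_mx_GL ug.
by rewrite -[RHS]mulmx1 -(map_mx1 phi) -(mulmxV ug) map_mxM mulKmx.
Qed.

Lemma integral_points_subgroup D : subgroup D -> subgroup (integral_points D).
Proof.
move=> [DGL D1 DM DV]; split=> [g []//||g h [ug Dg] [uh Dh]|g [ug Dg]].
- by split; [apply: unitmx1 | rewrite map_mx1].
- by split; [rewrite /GL /= unitmx_mul; apply/andP | rewrite map_mxM; apply: DM].
- by split; [rewrite /GL /= unitmx_inv | rewrite map_mx_invmx //; apply: DV].
Qed.

(** The condition on x and y is closed in each variable separately, so it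
    passes from T to D first in x, with y in T fixed, and then in y. *)
Lemma conj_normalizes_closure (D : set 'M[K]_n) (T : set 'M[R]_n) (g : 'M[R]_n) :
  subgroup D -> gl_closed D -> zdense_in [set map_mx phi x | x in T] D ->
  GL g -> T `<=` @GL R n ->
  (forall x y, T x -> T y ->
     let z := g *m y *m invmx g in T (z *m x *m invmx z)) ->
  forall x y, D x -> D y ->
     let z := map_mx phi g *m y *m invmx (map_mx phi g) in D (z *m x *m invmx z).
Proof.
move=> [DGL _ _ _] Dcl [TD DT] ug TGL norm; set c := map_mx phi g.
have uc : c \in unitmx by apply: map_mx_GL.
have conjE y : y \in unitmx -> invmx (c *m y *m invmx c) = c *m invmx y *m invmx c.
  move=> uy; have uz := unitmx_conj uc uy.
  apply: (can_inj (mulKmx uz)); rewrite mulmxV // !mulmxA mulmxKV // mulmxK // mulmxV //.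
have dense (Z : set 'M[K]_n) : gl_closed Z -> (forall x, T x -> Z (map_mx phi x)) -> D `<=` Z.
  move=> Zcl TZ x Dx; apply: (closure_gl_closed (X := [set map_mx phi x | x in T]) Zcl).
    by move=> _ [t Tt <-]; apply: TZ.
  by split; [apply: DGL | apply: DT].
have cst (F : 'M[K]_n) i j : regular_on (@GL K n) (fun=> F i j) by apply: regular_on_const.
have ent i j : regular_on (@GL K n) (fun x : 'M[K]_n => x i j) by apply: regular_on_entry.
have inv i j : regular_on (@GL K n) (fun x : 'M[K]_n => invmx x i j) by apply: regular_on_invmx.
have step1 y : T y -> forall x, D x ->
    let z := c *m map_mx phi y *m invmx c in D (z *m x *m invmx z).
  move=> Ty x Dx z; have uz : z \in unitmx by apply/(unitmx_conj uc)/map_mx_GL/TGL.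
  have : [set x | @GL K n x /\ D (z *m x *m invmx z)] x.
    apply: dense Dx => [|t Tt].
      apply: gl_closed_preimage => //; first exact: gl_closedT.
        by move=> w uw; apply: unitmx_conj.
      by do 2!apply: regular_on_mulmx => //.
    have ut := TGL _ Tt; split; first exact: map_mx_GL.
    have uy := TGL _ Ty.
    have uzR := unitmx_conj ug uy.
    have := TD _ (ex_intro2 _ _ _ (norm t y Tt Ty) erefl).
    by rewrite !map_mxM !map_mx_invmx // !map_mxM map_mx_invmx.
  by case.
move=> x y Dx Dy z; have ux := DGL _ Dx.
have : [set y | @GL K n y /\ D (c *m y *m invmx c *m x *m (c *m invmx y *m invmx c))] y.
  apply: dense Dy => [|t Tt].
    apply: gl_closed_preimage => //; first exact: gl_closedT.
      move=> w uw; have uw' : invmx w \in unitmx by rewrite unitmx_inv.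
      rewrite /GL /= unitmx_mul; apply/andP; split; last exact: unitmx_conj.
      by rewrite unitmx_mul; apply/andP; split; [apply: unitmx_conj | apply: ux].
    by do 4!apply: regular_on_mulmx => //.
  have ut := map_mx_GL (TGL _ Tt); split=> //.
  by rewrite -conjE //; apply: step1.
by case=> uy; rewrite -conjE.
Qed.

(** Containment in the normalizer of T is inherited along the edges of the
    normality graph: downwards trivially, upwards because conjugation by an
    element of the larger group preserves D. *)
Lemma lower_garland_integral_points (G D : set 'M[K]_n) (T : set 'M[R]_n) :
  subgroup G -> maximal_torus G D -> T = integral_points D ->
  zdense_in [set map_mx phi x | x in T] D ->
  lower_garland T (integral_points G) = Lat T (normalizer (integral_points G) T).
Proof.
move=> sG maxD TE dense; have [[[sD Dcl] _] DG _] := maxD.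
have sT : subgroup T by rewrite TE; apply: integral_points_subgroup.
have sG' := integral_points_subgroup sG.
have [TGL T1 TM TV] := sT.
have TG' : T `<=` integral_points G by rewrite TE => x [ux /DG].
set G' := integral_points G; set N := normalizer G' T.
have conj_eq (F : set 'M[R]_n) : subgroup F -> (forall g, F g -> conjg_set T g `<=` T) ->
    forall g, F g -> conjg_set T g = T.
  move=> [FGL _ _ FV] Fsub g Fg; apply/seteqP; split; first exact: Fsub.
  move=> x Tx; have ug := FGL _ Fg.
  exists (invmx g *m x *m g); last by rewrite !mulmxA mulmxV // mul1mx mulmxK.
  by apply: (Fsub _ (FV _ Fg)); exists x => //; rewrite invmxK.
have TN : T `<=` N.
  move=> g Tg; split; first exact: TG'.
  apply: (conj_eq T) => // {Tg}g Tg' _ [x Tx <-].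
  by apply: (TM _ _ (TM _ _ Tg' Tx)); apply: TV.
have key (H F : set 'M[R]_n) : Lat T G' F -> T `<=` H -> H `<=` N -> normal_in H F -> F `<=` N.
  move=> [sF TF FG'] TH HN [_ nHF] g Fg; split; first exact: FG'.
  apply: (conj_eq F) => // {Fg}g Fg _ [x Tx <-]; have [ug Gg] := FG' _ Fg.
  have /(conj_normalizes_closure sD Dcl dense ug TGL) norm : forall a b, T a -> T b ->
      let z := g *m b *m invmx g in T (z *m a *m invmx z).
    move=> a b Ta Tb z.
    have [_ zT] : N z by apply/HN/(nHF _ Fg); exists b => //; apply: TH.
    by rewrite -[X in X _]zT; exists a.
  have ux := TGL _ Tx; rewrite TE; split.
    by rewrite /GL /= !unitmx_mul unitmx_inv; move: ug ux; rewrite /GL /= => -> ->.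
  rewrite !map_mxM map_mx_invmx //; apply: (maximal_torus_absorbs sG maxD Gg norm).
  by apply: (dense.1); exists x.
apply/seteqP; split=> H.
  move=> [[sH TH HG'] conn]; split=> //; move: TN.
  elim: conn => // [H1 H2 [[_ TH1 _] L2 [n12|[H21 _]]] H1N|H1 H2 H3 _ IH12 _ IH23 /IH12 /IH23 //].
    exact: key n12.
  exact: subset_trans H1N.
move=> [sH TH HN]; have LH : Lat T G' H by split=> // g /HN [].
split=> //; apply: rt_step; split=> //; first by split.
by left; split=> // g /HN [_ ->].
Qed.

End IntegralPoints.

(** * Descent of the regular representation *)

Section Descent.
Variables (R K : comNzRingType) (phi : {rmorphism R -> K}) (S : algType R).
Variables (A : algType K) (tau : K -> S -> A).
Hypothesis ext : scalar_extension phi tau.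

(** Multiplication by the pure tensor of 1 and 1 and the identity are additive
    maps that agree on pure tensors, so they coincide. *)
Lemma tensor_one : tau 1 1 = 1.
Proof.
have [g [_ gE]] := tensor_universal ext (tensor_balanced ext).
have idE : idfun =1 g by apply: (gE (idfun : {additive A -> A})).
have mulE : tau 1 1 \*o idfun =1 g.
  apply: (gE (tau 1 1 \*o idfun : {additive A -> A})) => a s /=.
  by rewrite (tensor_mul ext) !mul1r.
by rewrite -[LHS]mulr1 -[RHS]/(idfun 1) idE -mulE.
Qed.

Section Coordinates.
Variables (n : nat) (omega : 'I_n -> S).
Hypotheses (basis : is_basis omega) (phi_inj : injective phi).

Lemma basis_free (c c' : 'rV[R]_n) :
  \sum_j c 0 j *: omega j = \sum_j c' 0 j *: omega j -> c = c'.
Proof.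
move=> e; have [d [_ dE]] := basis (\sum_j c 0 j *: omega j).
by rewrite -(dE c) // -(dE c').
Qed.

(** The coordinates in the basis, mapped to K, extend to the tensor product. *)
Lemma tensor_inj : injective (tau 1).
Proof.
have /choice [coord coordE] : forall s, exists c : 'rV[R]_n, s = \sum_j c 0 j *: omega j.
  by move=> s; have [c [cE _]] := basis s; exists c.
have coordD s u : coord (s + u) = coord s + coord u.
  apply: basis_free; rewrite -coordE {1}(coordE s) {1}(coordE u) -big_split /=.
  by apply: eq_bigr => j _; rewrite mxE scalerDl.
have coordZ r s : coord (r *: s) = r *: coord s.
  apply: basis_free; rewrite -coordE {1}(coordE s) scaler_sumr.
  by apply: eq_bigr => j _; rewrite mxE scalerA.
have bal : balanced phi (fun (a : K) s => a *: map_mx phi (coord s)).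
  split=> [a b s|a s u|a r s]; first by rewrite scalerDl.
    by rewrite coordD map_mxD scalerDr.
  by rewrite coordZ map_mxZ scalerA.
have [g [gE _]] := tensor_universal ext bal.
move=> s u su; have := gE 1 s; rewrite su gE !scale1r => /matrixP e.
rewrite (coordE s) (coordE u) (_ : coord u = coord s) //.
by apply/matrixP => i j; apply: phi_inj; have := e i j; rewrite !mxE.
Qed.

End Coordinates.

End Descent.

(** If M is the matrix of right multiplication by a unit a of A, expanding 1 in
    the basis writes a as the image of an element s of S with regular matrix M.  Right multiplication by s is then bijective on S, since
    M is invertible over R, and so s is a unit. *)
Lemma unit_matrices_descent (R K : comUnitRingType) (phi : {rmorphism R -> K})
    (S : algType R) (A : algType K) (tau : K -> S -> A) n (omega : 'I_n -> S)
    (M : 'M[R]_n) :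
  scalar_extension phi tau -> is_basis omega -> injective phi -> M \in unitmx ->
  unit_matrices (fun i => tau 1 (omega i)) (map_mx phi M) -> unit_matrices omega M.
Proof.
move=> ext basis phi_inj uM [a _ aE].
have [tauD tauD' tauZ] := tensor_balanced ext.
have tau0 b : tau b 0 = 0 by apply: (addrI (tau b 0)); rewrite -tauD' !addr0.
have tau_sum b (F : 'I_n -> S) : tau b (\sum_j F j) = \sum_j tau b (F j).
  by apply: (big_morph (tau b)) => [s u|]; [apply: tauD' | apply: tau0].
have scaleE r s : phi r *: tau 1 s = tau 1 (r *: s).
  by rewrite (tensor_scale ext) mulr1 -tauZ mul1r.
have tau1 : tau 1 1 = 1 := tensor_one ext.
have tauM s u : tau 1 s * tau 1 u = tau 1 (s * u) by rewrite (tensor_mul ext) mulr1.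
have {}aE i : tau 1 (omega i) * a = tau 1 (\sum_j M j i *: omega j).
  by rewrite aE tau_sum; apply: eq_bigr => j _; rewrite mxE scaleE.
have [c [c1 _]] := basis 1.
(* The expansion of 1 * a, with the basis of S in place of its image in A. *)
pose s := \sum_i c 0 i *: \sum_j M j i *: omega j.
have as_ : a = tau 1 s.
  rewrite -[a]mul1r -tau1 c1 !tau_sum mulr_suml; apply: eq_bigr => i _.
  by rewrite -scaleE -scalerAl aE scaleE.
have sE i : omega i * s = \sum_j M j i *: omega j.
  by apply: (tensor_inj ext basis phi_inj); rewrite -tauM -as_ aE.
have mulsE (d : 'cV[R]_n) :
    (\sum_i d i 0 *: omega i) * s = \sum_j (M *m d) j 0 *: omega j.
  rewrite mulr_suml; under eq_bigr do rewrite -scalerAl sE scaler_sumr.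
  rewrite exchange_big; apply: eq_bigr => j _ /=; rewrite mxE scaler_suml.
  by apply: eq_bigr => i _; rewrite scalerA mulrC.
pose b := \sum_i (invmx M *m c^T) i 0 *: omega i.
have bs : b * s = 1.
  rewrite mulsE mulKVmx // c1; apply: eq_bigr => j _; by rewrite mxE.
exists s => //; exists b; split=> //.
have [d [dE _]] := basis (s * b - 1).
have : (s * b - 1) * s = 0 by rewrite mulrBl -mulrA bs mulr1 mul1r subrr.
rewrite dE (_ : \sum_j _ = \sum_j d^T j 0 *: omega j); last by apply: eq_bigr => j _; rewrite mxE.
rewrite mulsE => e; have d0 : M *m d^T = 0.
  apply: trmx_inj; apply: (basis_free basis); transitivity (0 : S).
    by rewrite -[RHS]e; apply: eq_bigr => j _; rewrite mxE.
  by rewrite big1 // => j _; rewrite !mxE scale0r.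
have {}d0 : d = 0 by apply: trmx_inj; rewrite trmx0 -[d^T](mulKmx uM) d0 mulmx0.
apply/eqP; rewrite -subr_eq0 dE d0; apply/eqP.
by rewrite big1 // => j _; rewrite mxE scale0r.
Qed.

Theorem theorem4p1
  (R : idomainType) (S : algType R)
  (R_subring : injective (fun r : R => r%:A : S))
  (n : nat) (omega : 'I_n -> S) (omega_basis : is_basis omega)
  (K : closedFieldType) (iota : {rmorphism {fraction R} -> K})
  (K_closure : algebraic_closure iota)
  (KS : algType K) (tau : K -> S -> KS) (KS_ext : scalar_extension (via_frac iota) tau)
  (Gt : set 'M[K]_n) (Gt_closed : zclosed_subgroup Gt) :
  let T : set 'M[R]_n := unit_matrices omega in
  let Tt : set 'M[K]_n := unit_matrices (fun i => tau 1 (omega i)) in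
  let G' : set 'M[R]_n := [set g | GL g /\ Gt (map_mx (via_frac iota) g)] in
  let T' : set 'M[R]_n := T `&` G' in
  zconnected Gt ->
  reductive Gt ->
  maximal_torus Gt (Tt `&` Gt) ->
  zdense_in [set map_mx (via_frac iota) g | g in T'] (Tt `&` Gt) ->
  lower_garland T' G' = Lat T' (normalizer G' T').
Proof.
move=> T Tt G' T' _ _ maxD dense.
have phi_inj : injective (via_frac iota).
  by move=> r s /= /fmorph_inj /eqP; rewrite tofrac_eq => /eqP.
have T'E : T' = integral_points (via_frac iota) (Tt `&` Gt).
  apply/seteqP; split=> g.
    move=> T'g; have [_ [ug _]] := T'g; split=> //.
    by apply: dense.1; exists g.
  move=> [ug [Ttg Gtg]]; split=> //.
  exact: unit_matrices_descent KS_ext omega_basis phi_inj ug Ttg.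
exact: lower_garland_integral_points Gt_closed.1 maxD T'E dense.
Qed.
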